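(* Let $(T_n)_{n\ge 0}$ be the Tribonacci sequence, $T_0=0$, $T_1=1$, $T_2=1$, $T_{n+3}=T_{n+2}+T_{n+1}+T_n$ for $n\ge 0$. Let $\{x_n\}_{n\ge -1}$ be a well defined solution of the equation $$x_{n+1}=\frac{x_nx_{n-1}+x_{n-1}+1}{x_nx_{n-1}},\qquad n=0,1,\ldots.$$ Then, for $n=0,1,\ldots$, $$x_{2n+1}=\frac{T_{2n+1}+(T_{2n+3}-T_{2n+2})x_{-1}+T_{2n+2}x_{-1}x_0}{T_{2n}+(T_{2n+2}-T_{2n+1})x_{-1}+T_{2n+1}x_{-1}x_0},$$ $$x_{2n+2}=\frac{T_{2n+2}+(T_{2n+4}-T_{2n+3})x_{-1}+T_{2n+3}x_0x_{-1}}{T_{2n+1}+(T_{2n+3}-T_{2n+2})x_{-1}+T_{2n+2}x_0x_{-1}}.$$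
   Context: All quantities are real. A solution $\{x_n\}_{n\ge -1}$ of the equation is called well defined if $x_n\neq 0$ for all $n=-1,0,1,\ldots$ (so that every step of the recursion makes sense). *)

(* Defs.v *)
From mathcomp Require Import all_boot all_order all_algebra.
From mathcomp Require Import reals.

Set Implicit Arguments.
Unset Strict Implicit.
Unset Printing Implicit Defensive.

Import Order.TTheory GRing.Theory Num.Theory.
Local Open Scope ring_scope.

Fixpoint tribonacci (n : nat) : nat :=
  match n with
  | 0 => 0
  | 1 => 1
  | 2 => 1
  | ((k.+1 as k1).+1 as k2).+1 => tribonacci k2 + tribonacci k1 + tribonacci k
  end%N.

(* A sequence with index set {-1, 0, 1, ...} is represented by a function on
   [int]; its values below -1 are irrelevant and never constrained. *)
Definition solution (R : realType) (x : int -> R) : Prop :=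
  forall n : int, 0 <= n ->
    x (n + 1) = (x n * x (n - 1) + x (n - 1) + 1) / (x n * x (n - 1)).

Definition well_defined (R : realType) (x : int -> R) : Prop :=
  forall n : int, -1 <= n -> x n <> 0.

(* Main.v *)
(* The numerators y_k = T_k + (T_{k+2} - T_{k+1}) x_{-1} + T_{k+1} x_{-1} x_0
   satisfy the Tribonacci recurrence, and so do the products x_{-1} x_0 ... x_k:
   multiplying x_{n+1} = 1 + 1/x_n + 1/(x_n x_{n-1}) by x_{-1} x_0 ... x_n
   linearises the equation. Hence y_k = x_{-1} x_0 ... x_k, so
   y_{k+1} / y_k = x_{k+1}. *)
Require Import Defs.
From mathcomp Require Import all_boot all_order all_algebra.
From mathcomp Require Import reals ring.

Set Implicit Arguments.
Unset Strict Implicit.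
Unset Printing Implicit Defensive.

Import Order.TTheory GRing.Theory Num.Theory.
Local Open Scope ring_scope.

Lemma tribonacciE (n : nat) :
  tribonacci n.+3 = (tribonacci n.+2 + tribonacci n.+1 + tribonacci n)%N.
Proof. by []. Qed.

Definition tribonacci_comb (R : pzRingType) (a b : R) (k : nat) : R :=
  (tribonacci k)%:R
  + ((tribonacci k.+2)%:R - (tribonacci k.+1)%:R) * a
  + (tribonacci k.+1)%:R * a * b.

Lemma tribonacci_combE (R : comPzRingType) (a b : R) (k : nat) :
  tribonacci_comb a b k.+3 =
  tribonacci_comb a b k.+2 + tribonacci_comb a b k.+1 + tribonacci_comb a b k.
Proof.
by rewrite /tribonacci_comb (tribonacciE k.+2) (tribonacciE k.+1) tribonacciE
  !natrD; ring.
Qed.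

(** The factor [p] stands for the product of the terms before [x (n - 1)], so the summands on the
    right become consecutive partial products, and the nonlinear equation turns into a Tribonacci
    step. *)
Lemma solution_step (R : realType) (x : int -> R) (n : int) (p : R) :
  solution x -> well_defined x -> 0 <= n ->
  x (n + 1) * (x n * (x (n - 1) * p)) = x n * (x (n - 1) * p) + x (n - 1) * p + p.
Proof.
move=> x_sol x_wd n_ge0; rewrite (x_sol n n_ge0).
have xn_neq0 : x n != 0 by apply/eqP/x_wd/(le_trans _ n_ge0).
have xp_neq0 : x (n - 1) != 0.
  by apply/eqP/x_wd; rewrite lerBrDr addNr.
by field; rewrite xp_neq0 xn_neq0.
Qed.

(** The recurrence has order three, so the induction carries two consecutive ratios. Nonvanishing of
    [y k] is carried along to permit the final division. *)
Lemma solution_comb (R : realType) (x : int -> R) (k : nat) :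
  solution x -> well_defined x ->
  let y := tribonacci_comb (x (-1)) (x 0) in
  [/\ y k != 0, y k.+1 = x k.+1 * y k & y k.+2 = x k.+2 * y k.+1].
Proof.
move=> x_sol x_wd y.
have x_neq0 (n : nat) : x n != 0 by apply/eqP/x_wd.
elim: k => [|k [yk_neq0 yk1 yk2]].
  have xN1_neq0 : x (-1) != 0 by apply/eqP/x_wd.
  have y0 : y 0%N = x 0 * x (-1) by rewrite /y /tribonacci_comb /=; ring.
  (* The partial products preceding [y 0] are the empty product 1 and [x (-1)]; they serve as [p]
     for [n = 0] and [n = 1]. *)
  have step0 := solution_step 1 x_sol x_wd (lexx 0).
  rewrite add0r sub0r mulr1 -y0 in step0.
  have y1 : y 1%N = x 1 * y 0%N.
    by rewrite step0 y0 /y /tribonacci_comb /=; ring.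
  split=> //; first by rewrite y0 mulf_neq0 // (x_neq0 0%N).
  have := solution_step (x (-1)) x_sol x_wd (isT : 0 <= 1%:Z).
  rewrite subrr -y0 -y1 => ->.
  by rewrite y1 step0 y0 /y /tribonacci_comb /=; ring.
split=> //; first by rewrite yk1 mulf_neq0.
rewrite /y tribonacci_combE -/y.
(* With [p = y k], the two inductive ratios fold the nested products into [y k.+1] and [y k.+2]. *)
have := solution_step (y k) x_sol x_wd (isT : 0 <= k.+2%:Z).
have -> : k.+2%:Z + 1 = k.+3 by rewrite -PoszD addn1.
have -> : k.+2%:Z - 1 = k.+1 by rewrite subzn // subn1.
by rewrite -yk1 -yk2.
Qed.

Lemma solution_ratio (R : realType) (x : int -> R) (k : nat) :
  solution x -> well_defined x ->
  x k.+1 = tribonacci_comb (x (-1)) (x 0) k.+1 / tribonacci_comb (x (-1)) (x 0) k.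
Proof.
move=> x_sol x_wd; have [y_neq0 -> _] := solution_comb k x_sol x_wd.
by rewrite mulfK.
Qed.

Theorem corollary5 (R : realType) (x : int -> R)
  (x_sol : solution x) (x_wd : well_defined x) :
  let T (n : nat) : R := (tribonacci n)%:R in
  forall n : nat,
    x (2 * n + 1)%N%:Z =
      (T (2 * n + 1)%N + (T (2 * n + 3)%N - T (2 * n + 2)%N) * x (-1)
        + T (2 * n + 2)%N * x (-1) * x 0)
      / (T (2 * n)%N + (T (2 * n + 2)%N - T (2 * n + 1)%N) * x (-1)
        + T (2 * n + 1)%N * x (-1) * x 0)
    /\
    x (2 * n + 2)%N%:Z =
      (T (2 * n + 2)%N + (T (2 * n + 4)%N - T (2 * n + 3)%N) * x (-1)
        + T (2 * n + 3)%N * x 0 * x (-1))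
      / (T (2 * n + 1)%N + (T (2 * n + 3)%N - T (2 * n + 2)%N) * x (-1)
        + T (2 * n + 2)%N * x 0 * x (-1)).
Proof.
move=> T n; split; first by rewrite !(addnS _ _) addn0 solution_ratio.
(* The even-index formula has [x 0] before [x (-1)]; [tribonacci_comb] has the opposite order. *)
by rewrite !(mulrAC _ (x 0)) !(addnS _ _) addn0 solution_ratio.
Qed.
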